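(* Let $R$ be a commutative ring with unity, let $L = Id(R)$ be the multiplicative lattice of all ideals of $R$, and let $I$ be an ideal of $R$. Then $I$ is a $J$-ideal of $R$ if and only if $I$ is a $J$-element of $L$.
   Context: A proper ideal $I$ of a commutative ring $R$ with unity is a $J$-ideal if for all $a,b\in R$, $ab\in I$ with $a\notin J(R)$ (the Jacobson radical of $R$) implies $b\in I$. A multiplicative lattice is a complete lattice $L$ (least element $0$, greatest element $1$) with a commutative, associative binary operation $\cdot$ that distributes over arbitrary joins and satisfies $a\cdot 1=a$ for all $a$. An element $i$ is proper if $i\neq 1$. $L_*$ denotes the set of compact elements of $L$ ($c$ is compact if $c\le\bigvee_\alpha a_\alpha$ implies $c\le a_{\alpha_1}\vee\dots\vee a_{\alpha_n}$ for finitely many indices). $(a]=\{x\in L: x\le a\}$. A proper element $m$ is maximal if $m\le n<1$ implies $m=n$; the Jacobson radical of $L$ is $J(L)=\bigwedge\{m : m \text{ is a maximal element of } L\}$. The set $Id(R)$ of all ideals of $R$, ordered by inclusion and with ideal product as multiplication, is a multiplicative lattice. A proper element $i$ of $L$ is a $J$-element if for all $a,b\in L_*$, $a\cdot b\le i$ with $a\notin(J(L)]$ implies $b\le i$. *)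

(* Defs.v *)
From HB Require Import structures.
From mathcomp Require Import all_boot all_order all_algebra.
From mathcomp Require Import boolp classical_sets.

Set Implicit Arguments.
Unset Strict Implicit.
Unset Printing Implicit Defensive.

Import Order.TTheory GRing.Theory.

Local Open Scope classical_set_scope.
Local Open Scope ring_scope.

HB.mixin Record TBLattice_isComplete (d : Order.disp_t) L
    of Order.TBLattice d L := {
  bigjoin : set L -> L;
  bigjoinP : forall A : set L, supremums A (bigjoin A)
}.

#[short(type="completeLatticeType")]
HB.structure Definition CompleteLattice (d : Order.disp_t) :=
  { L of Order.TBLattice d L & TBLattice_isComplete d L }.

HB.mixin Record CompleteLattice_isMultiplicative (d : Order.disp_t) L
    of CompleteLattice d L := {
  lmul : L -> L -> L;
  lmulC : commutative lmul;
  lmulA : associative lmul;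
  lmul_bigjoin : forall (a : L) (A : set L),
    lmul a (bigjoin A) = bigjoin [set lmul a x | x in A];
  lmulx1 : forall a : L, lmul a \top%O = a
}.

#[short(type="multLatticeType")]
HB.structure Definition MultLattice (d : Order.disp_t) :=
  { L of CompleteLattice d L & CompleteLattice_isMultiplicative d L }.

Section CompleteLatticeTheory.
Context {d : Order.disp_t} {L : completeLatticeType d}.
Implicit Types (A : set L) (c m : L).

Definition bigmeet A : L := bigjoin (lbound A).

Lemma bigmeetP A : infimums A (bigmeet A).
Proof.
have [ub lub] := bigjoinP (lbound A); split=> [x Ax|x lx]; last exact: ub.
by apply: lub => y; apply.
Qed.

Definition compact_element c : Prop :=
  forall A, (c <= bigjoin A)%O ->
  exists2 s : seq L, [set` s] `<=` A & (c <= \join_(a <- s) a)%O.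

Definition maximal_element m : Prop :=
  m <> \top%O /\ forall n : L, (m <= n)%O -> (n < \top)%O -> m = n.

End CompleteLatticeTheory.

Definition lattice_jacobson {d : Order.disp_t} (L : completeLatticeType d) : L :=
  bigmeet [set m : L | maximal_element m].

Definition J_element {d : Order.disp_t} {L : multLatticeType d} (i : L) : Prop :=
  i <> \top%O /\
  forall a b : L, compact_element a -> compact_element b ->
    (lmul a b <= i)%O -> ~ (a <= lattice_jacobson L)%O -> (b <= i)%O.

(* MathComp's [idealr_closed] only covers proper ideals, and the lattice of
   ideals must contain the unit ideal. *)
Record ideal (R : comPzRingType) := Ideal {
  ideal_set :> set R;
  ideal0 : ideal_set 0;
  idealD : forall x y, ideal_set x -> ideal_set y -> ideal_set (x + y);
  idealMl : forall a x, ideal_set x -> ideal_set (a * x)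
}.

Section IdealConstructions.
Context {R : comPzRingType}.
Implicit Types (I J K : ideal R) (S : set R).

Lemma ideal_ext I J : ideal_set I = ideal_set J -> I = J.
Proof.
case: I J => [S s0 sD sM] [T t0 tD tM] /= eST.
move: t0 tD tM; rewrite -eST => t0 tD tM.
by congr Ideal; exact: Prop_irrelevance.
Qed.

Definition zero_ideal : ideal R.
Proof.
apply: (@Ideal R [set 0]) => //= [x y -> ->|a x ->].
  by rewrite addr0.
by rewrite mulr0.
Defined.

Definition unit_ideal : ideal R :=
  @Ideal R setT Logic.I (fun _ _ _ _ => Logic.I) (fun _ _ _ => Logic.I).

Definition idealI I J : ideal R :=
  @Ideal R (I `&` J) (conj (ideal0 I) (ideal0 J))
    (fun _ _ hx hy => conj (idealD hx.1 hy.1) (idealD hx.2 hy.2))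
    (fun a _ hx => conj (idealMl a hx.1) (idealMl a hx.2)).

Definition ideal_gen S : ideal R :=
  @Ideal R [set x | forall K, S `<=` K -> ideal_set K x]
    (fun K _ => ideal0 K)
    (fun _ _ hx hy K hK => idealD (hx K hK) (hy K hK))
    (fun a _ hx K hK => idealMl a (hx K hK)).

Definition ideal_mul I J : ideal R := ideal_gen [set a * b | a in I & b in J].

Lemma sub_ideal_gen S : S `<=` ideal_gen S.
Proof. by move=> x Sx K; apply. Qed.

Lemma ideal_gen_sub S K : (ideal_gen S `<=` K) <-> (S `<=` K).
Proof.
by split=> [h x /sub_ideal_gen /h //|h x]; apply.
Qed.

End IdealConstructions.

HB.instance Definition _ (R : comPzRingType) := gen_eqMixin (ideal R).
HB.instance Definition _ (R : comPzRingType) := gen_choiceMixin (ideal R).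

Fact ideal_display : Order.disp_t. Proof. exact: Order.Disp tt tt. Qed.

Section IdealLattice.
Variable R : comPzRingType.
Implicit Types (I J K : ideal R) (A : set (ideal R)).

Definition ideal_le : rel (ideal R) := fun I J => `[< I `<=` J >].

Fact ideal_le_refl : reflexive ideal_le.
Proof. by move=> I; apply/asboolP. Qed.

Fact ideal_le_anti : antisymmetric ideal_le.
Proof.
move=> I J /andP[/asboolP IJ /asboolP JI].
by apply: ideal_ext; apply/seteqP.
Qed.

Fact ideal_le_trans : transitive ideal_le.
Proof.
move=> J I K /asboolP IJ /asboolP JK.
by apply/asboolP; exact: subset_trans JK.
Qed.

HB.instance Definition _ := Order.Le_isPOrder.Build ideal_display (ideal R)
  ideal_le_refl ideal_le_anti ideal_le_trans.

Lemma ideal_leP I J : reflect (I `<=` J) (I <= J)%O.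
Proof. exact: asboolP. Qed.

Fact ideal_meetP I J K : (I <= idealI J K)%O = (I <= J)%O && (I <= K)%O.
Proof.
apply/ideal_leP/andP => [h|[/ideal_leP hJ /ideal_leP hK]].
  by split; apply/ideal_leP => x /h[].
by move=> x Ix; split; [exact: hJ|exact: hK].
Qed.

Fact ideal_joinP I J K :
  (ideal_gen (I `|` J) <= K)%O = (I <= K)%O && (J <= K)%O.
Proof.
apply/ideal_leP/andP => [/ideal_gen_sub h|[/ideal_leP hI /ideal_leP hJ]].
  by split; apply/ideal_leP => x ?; apply: h; [left|right].
by apply/ideal_gen_sub => x [/hI|/hJ].
Qed.

HB.instance Definition _ := Order.POrder_MeetJoin_isLattice.Build
  ideal_display (ideal R) ideal_meetP ideal_joinP.

Fact zero_ideal_le I : (zero_ideal <= I)%O.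
Proof. by apply/ideal_leP => x ->; exact: ideal0. Qed.

Fact le_unit_ideal I : (I <= unit_ideal)%O.
Proof. by apply/ideal_leP. Qed.

HB.instance Definition _ :=
  Order.hasBottom.Build ideal_display (ideal R) zero_ideal_le.
HB.instance Definition _ :=
  Order.hasTop.Build ideal_display (ideal R) le_unit_ideal.

Definition ideal_bigjoin A : ideal R := ideal_gen (\bigcup_(I in A) I).

Fact ideal_bigjoinP A : supremums A (ideal_bigjoin A).
Proof.
split=> [I AI|K ubK]; apply/ideal_leP.
  by move=> x Ix; apply: sub_ideal_gen; exists I.
by apply/ideal_gen_sub => x [I /ubK/ideal_leP]; apply.
Qed.

HB.instance Definition _ :=
  TBLattice_isComplete.Build ideal_display (ideal R) ideal_bigjoinP.

Lemma ideal_mul_le I J K :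
  reflect (forall a b, ideal_set I a -> ideal_set J b -> ideal_set K (a * b))
    (ideal_mul I J <= K)%O.
Proof.
apply: (iffP (ideal_leP _ _)) => [/ideal_gen_sub h a b Ia Jb|h].
  by apply: h; exists a => //; exists b.
by apply/ideal_gen_sub => _ [a Ia [b Jb <-]]; exact: h.
Qed.

Lemma ideal_mul_in I J a b :
  ideal_set I a -> ideal_set J b -> ideal_set (ideal_mul I J) (a * b).
Proof. by move: a b; apply/ideal_mul_le. Qed.

Fact ideal_mulC : commutative (@ideal_mul R).
Proof.
by move=> I J; apply/le_anti/andP; split; apply/ideal_mul_le => a b ha hb;
  rewrite mulrC; exact: ideal_mul_in.
Qed.

Definition ideal_colon K (a : R) : ideal R.
Proof.
apply: (@Ideal R [set x | ideal_set K (a * x)]) => /= [|x y hx hy|b x hx].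
- by rewrite mulr0; exact: ideal0.
- by rewrite mulrDr; exact: idealD.
- by rewrite mulrCA; exact: idealMl.
Defined.

Lemma ideal_colonE K a x :
  ideal_set (ideal_colon K a) x = ideal_set K (a * x).
Proof. by []. Qed.

Fact ideal_mulA : associative (@ideal_mul R).
Proof.
have le3 I J K : (ideal_mul I (ideal_mul J K) <= ideal_mul (ideal_mul I J) K)%O.
  apply/ideal_mul_le => a z Ia; move: z.
  have /ideal_leP : (ideal_mul J K <=
      ideal_colon (ideal_mul (ideal_mul I J) K) a)%O; last by apply.
  apply/ideal_mul_le => b c Jb Kc; rewrite ideal_colonE mulrA.
  by apply: ideal_mul_in => //; exact: ideal_mul_in.
move=> I J K; apply/le_anti/andP; split; first exact: le3.
rewrite ideal_mulC (ideal_mulC I J) (ideal_mulC I) (ideal_mulC J K).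
exact: le3.
Qed.

Fact ideal_mul_bigjoin I A :
  ideal_mul I (ideal_bigjoin A) = ideal_bigjoin [set ideal_mul I J | J in A].
Proof.
apply/le_anti/andP; split.
  apply/ideal_mul_le => a z Ia; move: z.
  have /ideal_leP : (ideal_bigjoin A <=
      ideal_colon (ideal_bigjoin [set ideal_mul I J | J in A]) a)%O;
    last by apply.
  apply: (ideal_bigjoinP A).2 => J AJ; apply/ideal_leP => x Jx; rewrite ideal_colonE.
  apply: sub_ideal_gen; exists (ideal_mul I J); first by exists J.
  exact: ideal_mul_in.
apply: (ideal_bigjoinP _).2 => _ [J AJ <-]; apply/ideal_mul_le => a b Ia Jb.
by apply: ideal_mul_in => //; apply: sub_ideal_gen; exists J.
Qed.

Fact ideal_mulx1 I : ideal_mul I \top%O = I.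
Proof.
apply/le_anti/andP; split; first apply/ideal_mul_le => a b Ia _.
  by rewrite mulrC; exact: idealMl.
by apply/ideal_leP => x Ix; rewrite -[x]mulr1; exact: ideal_mul_in.
Qed.

HB.instance Definition _ := CompleteLattice_isMultiplicative.Build
  ideal_display (ideal R) ideal_mulC ideal_mulA ideal_mul_bigjoin ideal_mulx1.

End IdealLattice.

Definition maximal_ideal (R : comPzRingType) (M : ideal R) : Prop :=
  ideal_set M <> setT /\
  forall N : ideal R, M `<=` N -> ideal_set N <> setT -> ideal_set M = N.

Definition ring_jacobson (R : comPzRingType) : set R :=
  \bigcap_(M in [set M : ideal R | maximal_ideal M]) M.

Definition J_ideal (R : comPzRingType) (I : ideal R) : Prop :=
  ideal_set I <> setT /\
  forall a b : R, ideal_set I (a * b) -> ~ ring_jacobson a -> ideal_set I b.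

(* Main.v *)
Require Import Defs.
From mathcomp Require Import all_boot all_order all_algebra.
From mathcomp Require Import boolp classical_sets.

(** J-ideals are defined by testing products of elements, J-elements by testing
    products of compact ideals.  Two facts let one pass between the tests.
    First, both tests exclude the same thing: a maximal element of the lattice
    of ideals is a maximal ideal, so the Jacobson radical of the lattice is the
    Jacobson radical of the ring ([lattice_jacobsonE]).  Second, an element [a]
    of the ring is faithfully represented by the principal ideal [(a)], which
    is compact ([compact_principal]) and satisfies [(a)(b) <= I] as soon as
    [a * b] lies in [I] ([principal_mul_le]).

    Hence a J-element is a J-ideal, by testing on principal ideals.  Conversely
    let [I] be a J-ideal and [A B <= I] with [A] not below the radical; a single
    [x] in [A] outside the radical gives [x * y] in [I] for every [y] in [B],
    hence [B <= I]. *)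

Set Implicit Arguments.
Unset Strict Implicit.
Unset Printing Implicit Defensive.

Import Order.TTheory GRing.Theory.

Local Open Scope classical_set_scope.
Local Open Scope ring_scope.

Section IdealLatticeFacts.
Variable R : comPzRingType.
Implicit Types (I J K M : ideal R) (A : set (ideal R)).

Lemma ideal_topP I : (I = \top%O) <-> (ideal_set I = setT).
Proof. by split=> [->//|IT]; exact: ideal_ext. Qed.

Lemma maximal_elementE M : maximal_element M <-> maximal_ideal M.
Proof.
rewrite /maximal_element /maximal_ideal.
split=> -[MT Mmax]; split.
- by move/ideal_topP.
- move=> N MN NT; congr ideal_set; apply: Mmax; first exact/ideal_leP.
  by rewrite ltx1; apply/eqP => /ideal_topP.
- by move/ideal_topP.
- move=> N /ideal_leP MN; rewrite ltx1 => /eqP NT.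
  by apply/ideal_ext/Mmax => // /ideal_topP.
Qed.

(** The meet in the lattice of ideals is computed as a join of lower bounds;
    the intersection of the members of [A] is itself an ideal, hence the
    greatest of these lower bounds. *)
Lemma ideal_bigmeetE A : ideal_set (bigmeet A) = \bigcap_(K in A) K.
Proof.
have [lb glb] := bigmeetP A; apply/seteqP; split=> [x Ax K AK|x].
  by have /ideal_leP := lb K AK; apply.
pose C : ideal R := @Ideal R (\bigcap_(K in A) K) (fun K _ => ideal0 K)
  (fun _ _ hx hy K AK => idealD (hx K AK) (hy K AK))
  (fun a _ hx K AK => idealMl a (hx K AK)).
have /ideal_leP : (C <= bigmeet A)%O.
  by apply: glb => K AK; apply/ideal_leP => y; exact.
exact.
Qed.

Lemma lattice_jacobsonE :
  ideal_set (lattice_jacobson (ideal R)) = ring_jacobson (R := R).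
Proof.
rewrite ideal_bigmeetE /ring_jacobson; congr bigcap.
by apply/funext => M; apply/propext; exact: maximal_elementE.
Qed.

Definition principal_ideal (a : R) : ideal R := ideal_gen [set a].

Lemma principal_leP a K : (principal_ideal a <= K)%O <-> ideal_set K a.
Proof.
split=> [/ideal_leP/ideal_gen_sub|Ka]; first exact.
by apply/ideal_leP/ideal_gen_sub => _ ->.
Qed.

Lemma principal_mul_le a b K :
  ideal_set K (a * b) -> (ideal_mul (principal_ideal a) (principal_ideal b) <= K)%O.
Proof.
move=> Kab; apply/ideal_mul_le => x y ax; move: y.
(* Each factor is cleared in turn: it suffices that its generator lies in
   the ideal quotient of [K] by the other factor. *)
have /ideal_leP : (principal_ideal b <= ideal_colon K x)%O; last exact.
apply/principal_leP; rewrite ideal_colonE mulrC.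
have /ideal_leP : (principal_ideal a <= ideal_colon K b)%O; last exact.
by apply/principal_leP; rewrite ideal_colonE mulrC.
Qed.

(** The elements lying in some finite subjoin form an ideal [F], because two
    finite subfamilies have a finite union.  As [F] contains every member of
    [A], it contains the join, which is defined by generation. *)
Lemma bigjoin_finite A x : ideal_set (bigjoin A) x ->
  exists2 s : seq (ideal R), [set` s] `<=` A & ideal_set (\join_(K <- s) K)%O x.
Proof.
pose F := [set y | exists2 s : seq (ideal R),
  [set` s] `<=` A & ideal_set (\join_(K <- s) K)%O y].
have F0 : F 0 by exists [::] => //; exact: ideal0.
have FD y z : F y -> F z -> F (y + z).
  move=> [s sA sy] [t tA tz]; exists (s ++ t).
    by move=> K /=; rewrite mem_cat => /orP[/sA|/tA].
  rewrite big_cat; apply: idealD.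
    by have /ideal_leP := leUl (\join_(K <- s) K)%O (\join_(K <- t) K)%O; apply.
  by have /ideal_leP := leUr (\join_(K <- t) K)%O (\join_(K <- s) K)%O; apply.
have FM a y : F y -> F (a * y).
  by move=> [s sA sy]; exists s => //; exact: idealMl.
suff /ideal_leP : (bigjoin A <= Ideal F0 FD FM)%O by apply.
apply: (bigjoinP A).2 => K AK; apply/ideal_leP => y Ky /=.
exists [:: K]; first by move=> J /=; rewrite inE => /eqP ->.
by rewrite big_seq1.
Qed.

Lemma compact_principal a : compact_element (principal_ideal a).
Proof.
move=> A /principal_leP/bigjoin_finite[s sA sa].
by exists s => //; apply/principal_leP.
Qed.

End IdealLatticeFacts.

Theorem theorem3p10 (R : comPzRingType) (I : ideal R) :
  J_ideal I <-> @J_element ideal_display (ideal R) I.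
Proof.
split=> -[IT IJ]; split.
- by move/ideal_topP.
- move=> A B _ _ /ideal_mul_le AB nAJ; apply/ideal_leP => y By.
  have [x Ax nJx] : exists2 x, ideal_set A x & ~ ring_jacobson x.
    apply: contrapT => nex; apply: nAJ; apply/ideal_leP => x Ax.
    by rewrite lattice_jacobsonE; apply: contrapT => nJx; apply: nex; exists x.
  by apply: IJ nJx; exact: AB.
- by move/ideal_topP.
- move=> a b Iab nJa; apply/principal_leP.
  apply: (IJ (principal_ideal a)); [exact: compact_principal.. | |].
    exact: principal_mul_le.
  by move/principal_leP; rewrite lattice_jacobsonE.
Qed.
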